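(* There exist absolute constants $c_0>0$ and $\eta>0$ such that the following holds. Let $\bm{M}_\star\in\mathbb{R}^{n_1\times n_2}$ have rank $r$, with ground-truth factors $\bm{X}_\star,\bm{Y}_\star$, $\bm{Z}_\star$, $\sigma_{\max},\sigma_{\min},\kappa$ as in the context. Let $\bm{Z}_0=\begin{bmatrix}\bm{X}_0\\ \bm{Y}_0\end{bmatrix}\in\mathbb{R}^{(n_1+n_2)\times r}$ be any initialization satisfying \[ \min_{\bm{R}\in\mathcal{O}^{r\times r}}\|\bm{Z}_0\bm{R}-\bm{Z}_\star\|_{\mathrm{F}}\le c_0\,\frac{1}{\kappa^{3/2}}\,\sigma_{\min}^{1/2}, \] and define the gradient descent iterates \[ \bm{X}_{t+1}=\bm{X}_t-\frac{\eta}{\sigma_{\max}}(\bm{X}_t\bm{Y}_t^\top-\bm{M}_\star)\bm{Y}_t,\qquad \bm{Y}_{t+1}=\bm{Y}_t-\frac{\eta}{\sigma_{\max}}(\bm{X}_t\bm{Y}_t^\top-\bm{M}_\star)^\top\bm{X}_t, \] with $\bm{Z}_t=\begin{bmatrix}\bm{X}_t\\ \bm{Y}_t\end{bmatrix}$. Then for all $t\ge0$, \[ \mathrm{dist}(\bm{Z}_t,\bm{Z}_\star)\le\Big(1-\frac{\eta}{50\kappa}\Big)^t\,\mathrm{dist}(\bm{Z}_0,\bm{Z}_\star). \]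
   Context: $\bm{M}_\star\in\mathbb{R}^{n_1\times n_2}$ has rank $r$ and compact SVD $\bm{M}_\star=\bm{U}_\star\bm{\Sigma}_\star\bm{V}_\star^\top$; $\bm{X}_\star=\bm{U}_\star\bm{\Sigma}_\star^{1/2}$, $\bm{Y}_\star=\bm{V}_\star\bm{\Sigma}_\star^{1/2}$, $\bm{Z}_\star=\begin{bmatrix}\bm{X}_\star\\ \bm{Y}_\star\end{bmatrix}$. $\sigma_{\max}=\sigma_1(\bm{M}_\star)$, $\sigma_{\min}=\sigma_r(\bm{M}_\star)$, $\kappa=\sigma_{\max}/\sigma_{\min}$. $\mathcal{O}^{r\times r}$ denotes the $r\times r$ orthogonal matrices. For $\bm{Z}=\begin{bmatrix}\bm{X}\\ \bm{Y}\end{bmatrix}$, $\mathrm{dist}(\bm{Z},\bm{Z}_\star)=\inf_{\bm{P}\in\mathbb{R}^{r\times r}\text{ invertible}}\sqrt{\|\bm{X}\bm{P}-\bm{X}_\star\|_{\mathrm{F}}^2+\|\bm{Y}\bm{P}^{-\top}-\bm{Y}_\star\|_{\mathrm{F}}^2}$, where $\bm{P}^{-\top}=(\bm{P}^{-1})^\top$. *)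

(* Defs.v *)
(* over Stdlib's concrete reals R (a realType via Rstruct),
   so that the constants c0, eta are genuinely absolute. *)
From HB Require Import structures.
From mathcomp Require Import all_boot all_order all_algebra.
From mathcomp Require Import all_classical all_reals.
From mathcomp Require Import Rstruct.
Set Implicit Arguments. Unset Strict Implicit. Unset Printing Implicit Defensive.
Import Order.TTheory GRing.Theory Num.Theory.
Local Open Scope ring_scope.
Local Open Scope classical_set_scope.

Notation RR := Rdefinitions.R.

Definition fnorm (m n : nat) (A : 'M[RR]_(m, n)) : RR :=
  Num.sqrt (\sum_(i < m) \sum_(j < n) (A i j) ^+ 2).

Definition orthogonal (r : nat) (Q : 'M[RR]_r) : Prop := Q^T *m Q = 1%:M.

Definition compact_svd (n1 n2 r : nat) (M : 'M[RR]_(n1, n2))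
  (U : 'M[RR]_(n1, r)) (s : 'rV[RR]_r) (V : 'M[RR]_(n2, r)) : Prop :=
  [/\ U^T *m U = 1%:M, V^T *m V = 1%:M, (forall i, 0 < s 0 i)
    & M = U *m diag_mx s *m V^T].

Definition sqrt_diag (r : nat) (s : 'rV[RR]_r) : 'M[RR]_r :=
  diag_mx (\row_i Num.sqrt (s 0 i)).

Definition sigma_max (r : nat) (s : 'rV[RR]_r) : RR :=
  \big[Num.max/0]_(i < r) s 0 i.
Definition sigma_min (r : nat) (s : 'rV[RR]_r) : RR :=
  \big[Num.min/sigma_max s]_(i < r) s 0 i.
Definition kappa (r : nat) (s : 'rV[RR]_r) : RR := sigma_max s / sigma_min s.

Definition orth_dist (m r : nat) (Z Zs : 'M[RR]_(m, r)) : RR :=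
  inf [set x | exists Q : 'M[RR]_r, orthogonal Q /\ x = fnorm (Z *m Q - Zs)].

Definition dist (n1 n2 r : nat) (X : 'M[RR]_(n1, r)) (Y : 'M[RR]_(n2, r))
  (Xs : 'M[RR]_(n1, r)) (Ys : 'M[RR]_(n2, r)) : RR :=
  inf [set x | exists P : 'M[RR]_r, P \in unitmx /\
        x = Num.sqrt (fnorm (X *m P - Xs) ^+ 2
                      + fnorm (Y *m (invmx P)^T - Ys) ^+ 2)].

Fixpoint gd (n1 n2 r : nat) (eta smax : RR) (M : 'M[RR]_(n1, n2))
  (X0 : 'M[RR]_(n1, r)) (Y0 : 'M[RR]_(n2, r)) (t : nat)
  : 'M[RR]_(n1, r) * 'M[RR]_(n2, r) :=
  match t with
  | 0 => (X0, Y0)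
  | t'.+1 =>
    let (X, Y) := gd eta smax M X0 Y0 t' in
    (X - (eta / smax) *: ((X *m Y^T - M) *m Y),
     Y - (eta / smax) *: ((X *m Y^T - M)^T *m X))
  end.

(* Main.v *)
Require Import Defs.
From HB Require Import structures.
From mathcomp Require Import all_boot all_order all_algebra.
From mathcomp Require Import all_classical all_reals.
From mathcomp Require Import Rstruct.
From mathcomp Require Import ring lra.
Set Implicit Arguments. Unset Strict Implicit. Unset Printing Implicit Defensive.
Import Order.TTheory GRing.Theory Num.Theory.
Local Open Scope ring_scope.

(** Write [E = X Y^T - M], [delta] for the misfit of an alignment [P], [a^2] and
    [b^2] for the extreme singular values, and [h = eta / a^2].  Keeping [P] fixed
    over one step changes [delta^2] by at most [- (3/2) h |E|^2] plus error terms of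
    size [h |E| delta (delta + a |P^T P - 1|)].  Choosing [P] so that [X P - Xs] is
    orthogonal to the columns of [U] shows [b dist <= 2 |E|] near the solution; hence
    the errors are absorbed as soon as [|P^T P - 1|] is at most a small multiple of
    [b / a].  After rotating the initial point by a near-optimal orthogonal matrix,
    a near-optimal [P] stays that close to the identity because the iterates
    move by at most [6 eta dist] per step, a geometric series with sum at most
    [300 kappa dist_0].  The infima are never assumed to be attained: all estimates hold
    for every [P] whose misfit is close to the infimum. *)

(** * The Frobenius inner product and norm *)

Definition ip (m n : nat) (A B : 'M[RR]_(m, n)) : RR := \tr (A *m B^T).

Section InnerProduct.
Context {m n : nat}.
Implicit Types A B C : 'M[RR]_(m, n).

Lemma ipE A B : ip A B = \sum_i \sum_j A i j * B i j.
Proof.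
apply: eq_bigr => i _; rewrite mxE; apply: eq_bigr => j _; by rewrite mxE.
Qed.

Lemma ipC A B : ip A B = ip B A.
Proof. by rewrite /ip -mxtrace_tr trmx_mul trmxK. Qed.

Lemma ipDl A B C : ip (A + B) C = ip A C + ip B C.
Proof. by rewrite /ip mulmxDl raddfD. Qed.

Lemma ipZl x A B : ip (x *: A) B = x * ip A B.
Proof. by rewrite /ip -scalemxAl linearZ. Qed.

Lemma ipNl A B : ip (- A) B = - ip A B.
Proof. by rewrite -scaleN1r ipZl mulN1r. Qed.

Lemma ipDr A B C : ip A (B + C) = ip A B + ip A C.
Proof. by rewrite ![ip A _]ipC ipDl. Qed.

Lemma ipZr x A B : ip A (x *: B) = x * ip A B.
Proof. by rewrite ![ip A _]ipC ipZl. Qed.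

Lemma ipNr A B : ip A (- B) = - ip A B.
Proof. by rewrite ![ip A _]ipC ipNl. Qed.

Lemma fnorm_ge0 A : 0 <= fnorm A.
Proof. exact: sqrtr_ge0. Qed.

Lemma fnorm_sqr A : fnorm A ^+ 2 = ip A A.
Proof.
rewrite sqr_sqrtr; first by rewrite ipE.
by apply: sumr_ge0 => i _; apply: sumr_ge0 => j _; exact: sqr_ge0.
Qed.

Lemma fnorm0 : fnorm (0 : 'M[RR]_(m, n)) = 0.
Proof.
rewrite /fnorm big1 ?sqrtr0// => i _; rewrite big1// => j _.
by rewrite mxE expr0n.
Qed.

Lemma fnorm_eq0 A : fnorm A = 0 -> A = 0.
Proof.
move=> A0; have := fnorm_sqr A; rewrite A0 expr0n/= ipE => /esym/eqP.
rewrite psumr_eq0; last by move=> i _; apply: sumr_ge0 => j _; exact: sqr_ge0.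
move=> /allP h; apply/matrixP => i j; rewrite mxE.
have := h i (mem_index_enum i); rewrite /= psumr_eq0; last by move=> ? _; exact: sqr_ge0.
by move=> /allP /(_ j (mem_index_enum j))/=; rewrite mulf_eq0 orbb => /eqP.
Qed.

Lemma fnormZ x A : fnorm (x *: A) = `|x| * fnorm A.
Proof.
apply/eqP; rewrite -(@eqrXn2 _ 2)// ?fnorm_ge0 ?mulr_ge0 ?fnorm_ge0//.
by rewrite exprMn !fnorm_sqr ipZl ipZr real_normK ?num_real// expr2 mulrA.
Qed.

Lemma fnormN A : fnorm (- A) = fnorm A.
Proof. by rewrite -scaleN1r fnormZ normrN1 mul1r. Qed.

Lemma fnormD_sqr A B :
  fnorm (A + B) ^+ 2 = fnorm A ^+ 2 + 2 * ip A B + fnorm B ^+ 2.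
Proof. rewrite !fnorm_sqr ipDl !ipDr (ipC B A); ring. Qed.

Lemma fnormB_sqr A B :
  fnorm (A - B) ^+ 2 = fnorm A ^+ 2 - 2 * ip A B + fnorm B ^+ 2.
Proof. by rewrite fnormD_sqr ipNr fnormN mulrN. Qed.

(** Cauchy-Schwarz, from expanding the square of the norm of [fnorm B *: A - fnorm A *: B]. *)
Lemma ip_le A B : ip A B <= fnorm A * fnorm B.
Proof.
have [/fnorm_eq0->|A0] := eqVneq (fnorm A) 0.
  by rewrite fnorm0 mul0r -(scale0r A) ipZl mul0r.
have [/fnorm_eq0->|B0] := eqVneq (fnorm B) 0.
  by rewrite fnorm0 mulr0 -(scale0r B) ipZr mul0r.
have p : 0 < fnorm A * fnorm B by rewrite mulr_gt0// lt0r ?A0 ?B0 fnorm_ge0.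
have := sqr_ge0 (fnorm (fnorm B *: A - fnorm A *: B)).
rewrite fnormB_sqr !fnormZ ipZl ipZr !ger0_norm ?fnorm_ge0// => h.
rewrite -(ler_pM2l p); nra.
Qed.

Lemma ip_ge A B : - (fnorm A * fnorm B) <= ip A B.
Proof. by rewrite lerNl -ipNl (le_trans (ip_le _ _))// fnormN. Qed.

Lemma fnormD_le A B : fnorm (A + B) <= fnorm A + fnorm B.
Proof.
rewrite -(@ler_pXn2r _ 2)// ?nnegrE ?addr_ge0 ?fnorm_ge0//.
rewrite fnormD_sqr; have := ip_le A B; nra.
Qed.

Lemma fnormB_le A B : fnorm (A - B) <= fnorm A + fnorm B.
Proof. by rewrite -(fnormN B) fnormD_le. Qed.

Lemma fnorm_tr A : fnorm A^T = fnorm A.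
Proof.
rewrite /fnorm exchange_big; congr Num.sqrt.
by apply: eq_bigr => i _; apply: eq_bigr => j _; rewrite mxE.
Qed.

End InnerProduct.

Lemma ip_mulr m n p (A : 'M[RR]_(m, p)) (B : 'M_(m, n)) (C : 'M_(n, p)) :
  ip A (B *m C) = ip (A *m C^T) B.
Proof. by rewrite /ip trmx_mul mulmxA. Qed.

Lemma ip_mull m n p (A : 'M[RR]_(m, p)) (B : 'M_(m, n)) (C : 'M_(n, p)) :
  ip A (B *m C) = ip (B^T *m A) C.
Proof. by rewrite /ip trmx_mul mulmxA mxtrace_mulC mulmxA. Qed.

(** Each entry of the product is the inner product of a row of [A] and a column of [B];
    Cauchy-Schwarz bounds it, and the squared bounds sum to the product of the squared norms. *)
Lemma fnorm_mul m n p (A : 'M[RR]_(m, n)) (B : 'M_(n, p)) :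
  fnorm (A *m B) <= fnorm A * fnorm B.
Proof.
rewrite -(@ler_pXn2r _ 2)// ?nnegrE ?mulr_ge0 ?fnorm_ge0// exprMn.
have -> : fnorm A ^+ 2 = \sum_i fnorm (row i A) ^+ 2.
  rewrite fnorm_sqr ipE; apply: eq_bigr => i _.
  by rewrite fnorm_sqr ipE big_ord1; apply: eq_bigr => j _; rewrite !mxE.
have -> : fnorm B ^+ 2 = \sum_j fnorm (col j B)^T ^+ 2.
  rewrite -fnorm_tr fnorm_sqr ipE; apply: eq_bigr => i _.
  by rewrite fnorm_sqr ipE big_ord1; apply: eq_bigr => j _; rewrite !mxE.
rewrite fnorm_sqr ipE mulr_suml; apply: ler_sum => i _.
rewrite mulr_sumr; apply: ler_sum => j _.
have -> : (A *m B) i j = ip (row i A) (col j B)^T.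
  by rewrite ipE big_ord1 mxE; apply: eq_bigr => k _; rewrite !mxE.
rewrite -expr2 -exprMn -ler_sqrt; last by rewrite sqr_ge0.
rewrite !sqrtr_sqr [leRHS]ger0_norm ?mulr_ge0 ?fnorm_ge0//.
by rewrite ler_norml ip_le ip_ge.
Qed.

(** * Spectral norm bounds *)

(** An upper bound on the spectral norm, tested on matrices of any height instead of vectors, so
    that it applies directly inside Frobenius estimates. *)
Definition op_le (m n : nat) (X : 'M[RR]_(m, n)) (a : RR) : Prop :=
  forall p (A : 'M_(p, m)), fnorm (A *m X) <= a * fnorm A.

Section OperatorBounds.
Context {m n : nat}.
Implicit Types X Y : 'M[RR]_(m, n).

Lemma op_le_fnorm X : op_le X (fnorm X).
Proof. by move=> p A; rewrite mulrC fnorm_mul. Qed.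

Lemma op_le_weak X a b : a <= b -> op_le X a -> op_le X b.
Proof.
by move=> ab h p A; rewrite (le_trans (h _ _))// ler_wpM2r// fnorm_ge0.
Qed.

Lemma op_leD X Y a b : op_le X a -> op_le Y b -> op_le (X + Y) (a + b).
Proof.
move=> hX hY p A; rewrite mulmxDr (le_trans (fnormD_le _ _))// mulrDl.
by rewrite lerD ?hX ?hY.
Qed.

Lemma op_le_near X Y a d : op_le Y a -> fnorm (X - Y) <= d -> op_le X (a + d).
Proof.
move=> hY hd; rewrite -(subrK Y X) addrC; apply: op_leD => //.
exact: op_le_weak hd (op_le_fnorm _).
Qed.

(* By duality: [|A X^T|^2 = <A, (A X^T) X>], then Cauchy-Schwarz. *)
Lemma op_le_tr X a : 0 <= a -> op_le X a -> op_le X^T a.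
Proof.
move=> a0 h p A; have [->|z] := eqVneq (fnorm (A *m X^T)) 0.
  by rewrite mulr_ge0 ?fnorm_ge0.
have zp : 0 < fnorm (A *m X^T) by rewrite lt0r z fnorm_ge0.
rewrite -(ler_pM2l zp) -expr2 fnorm_sqr ip_mulr trmxK ipC.
rewrite (le_trans (ip_le _ _))//.
rewrite mulrC; have := h _ (A *m X^T); have := fnorm_ge0 A; nra.
Qed.

Lemma fnorm_mul_opl p X (A : 'M_(n, p)) a :
  0 <= a -> op_le X a -> fnorm (X *m A) <= a * fnorm A.
Proof.
by move=> a0 /(op_le_tr a0) h; rewrite -fnorm_tr trmx_mul -(fnorm_tr A).
Qed.

End OperatorBounds.
Lemma op_le_mul m n p (X : 'M[RR]_(m, n)) (Y : 'M_(n, p)) a b :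
  0 <= b -> op_le X a -> op_le Y b -> op_le (X *m Y) (b * a).
Proof.
move=> b0 hX hY q A; rewrite mulmxA (le_trans (hY _ _))//.
by rewrite -mulrA ler_wpM2l.
Qed.


Lemma fnorm_mul_isom m n p (V : 'M[RR]_(m, n)) (A : 'M_(p, n)) :
  V^T *m V = 1%:M -> fnorm (A *m V^T) = fnorm A.
Proof.
move=> VV; apply/eqP; rewrite -(@eqrXn2 _ 2)// ?fnorm_ge0//.
by rewrite !fnorm_sqr ip_mulr trmxK -mulmxA VV mulmx1.
Qed.

Lemma op_le_isom m n (V : 'M[RR]_(m, n)) : V^T *m V = 1%:M -> op_le V 1.
Proof.
move=> VV; rewrite -(trmxK V); apply: op_le_tr => // p A.
by rewrite fnorm_mul_isom// mul1r.
Qed.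

Lemma fnorm_mul_diag m n (A : 'M[RR]_(m, n)) (d : 'rV_n) a b :
  0 <= b -> (forall i, b <= d 0 i <= a) ->
  b * fnorm A <= fnorm (A *m diag_mx d) <= a * fnorm A.
Proof.
move=> b0 h.
(* The sign of [a] can only be read off at some index, so the case without columns is treated
   apart. *)
have [->|[i0 a0]] : A = 0 \/ exists i : 'I_n, True.
- case: n A d h => [|n] A d h; last by right; exists ord0.
  by left; apply/matrixP => i [].
- by rewrite mul0mx !fnorm0 !mulr0 lexx.
have {}a0 : 0 <= a by have /andP[? ?] := h i0; lra.
rewrite -(@ler_pXn2r _ 2 _ (b * _))// -?(@ler_pXn2r _ 2 _ (fnorm _))//
  ?nnegrE ?mulr_ge0 ?fnorm_ge0// !exprMn.
rewrite !fnorm_sqr !ipE !mulr_sumr.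
apply/andP; split; apply: ler_sum => i _; rewrite mulr_sumr; apply: ler_sum => j _;
  rewrite mul_mx_diag mxE; have /andP[h1 h2] := h j;
  have := sqr_ge0 (A i j); set x := A i j; move=> hx.
- have : b ^+ 2 <= d 0 j ^+ 2 by rewrite ler_pXn2r ?nnegrE//; lra.
  move=> hh; nra.
- have : d 0 j ^+ 2 <= a ^+ 2 by rewrite ler_pXn2r ?nnegrE//; lra.
  move=> hh; nra.
Qed.

Lemma unitmx_bounded_below n (A : 'M[RR]_n) b :
  0 < b -> (forall v : 'rV_n, b * fnorm v <= fnorm (v *m A)) -> A \in unitmx.
Proof.
move=> b0 h; rewrite -row_free_unit; apply: inj_row_free => v vA.
apply: fnorm_eq0; apply/le_anti; rewrite fnorm_ge0 andbT.
by rewrite -(ler_pM2l b0) mulr0 (le_trans (h v))// vA fnorm0.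
Qed.

(** * The misfit of an alignment and its infimum *)

Section Gap.
Context {n1 n2 r : nat}.
Implicit Types (X : 'M[RR]_(n1, r)) (Y : 'M[RR]_(n2, r)) (P : 'M[RR]_r).

(** The quantity whose infimum over invertible [P] is [dist]. *)
Definition gap X Y Xs Ys P : RR :=
  Num.sqrt (fnorm (X *m P - Xs) ^+ 2 + fnorm (Y *m (invmx P)^T - Ys) ^+ 2).

Lemma gap_ge0 X Y Xs Ys P : 0 <= gap X Y Xs Ys P.
Proof. exact: sqrtr_ge0. Qed.

Lemma gap_sqr X Y Xs Ys P :
  gap X Y Xs Ys P ^+ 2 =
  fnorm (X *m P - Xs) ^+ 2 + fnorm (Y *m (invmx P)^T - Ys) ^+ 2.
Proof. by rewrite sqr_sqrtr// addr_ge0// sqr_ge0. Qed.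

Lemma fnorm_gapl X Y Xs Ys P : fnorm (X *m P - Xs) <= gap X Y Xs Ys P.
Proof.
rewrite -(@ler_pXn2r _ 2)// ?nnegrE ?fnorm_ge0 ?gap_ge0//.
by rewrite gap_sqr lerDl sqr_ge0.
Qed.

Lemma fnorm_gapr X Y Xs Ys P :
  fnorm (Y *m (invmx P)^T - Ys) <= gap X Y Xs Ys P.
Proof.
rewrite -(@ler_pXn2r _ 2)// ?nnegrE ?fnorm_ge0 ?gap_ge0//.
by rewrite gap_sqr lerDr sqr_ge0.
Qed.

Lemma dist_le_gap X Y Xs Ys P :
  P \in unitmx -> dist X Y Xs Ys <= gap X Y Xs Ys P.
Proof.
move=> uP; apply: ge_inf; last by exists P.
by exists 0 => _ [Q [_ ->]]; exact: sqrtr_ge0.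
Qed.

Lemma gap_lt X Y Xs Ys z :
  dist X Y Xs Ys < z -> exists2 P, P \in unitmx & gap X Y Xs Ys P < z.
Proof.
move=> /inf_lt[]; last by move=> _ [P [uP ->]] h; exists P.
by exists (gap X Y Xs Ys 1%:M), 1%:M; rewrite unitmx1.
Qed.

Lemma dist_ge0 X Y Xs Ys : 0 <= dist X Y Xs Ys.
Proof.
rewrite leNgt; apply/negP => /gap_lt[P _].
by rewrite ltNge gap_ge0.
Qed.

End Gap.

(** * Alignments close to the identity, and auxiliary estimates *)

(** Write [W (P - 1) = (X P - W) - (X - W) (P - 1) - (X - W)]. The middle term is at most [b / 2]
    times the norm of [P - 1] and is absorbed on the left, which costs the factor 2. This serves for
    [X] with [P] and for [Y] with the inverse transpose of [P]. *)
Lemma fnorm_subid_near m r (X W : 'M[RR]_(m, r)) (P : 'M_r) b B d :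
  0 < b -> (forall p (A : 'M_(p, r)), b * fnorm A <= fnorm (A *m W^T)) ->
  fnorm (X - W) <= B -> 2 * B <= b -> fnorm (X *m P - W) <= d ->
  fnorm (P - 1%:M) <= 2 * (d + B) / b.
Proof.
move=> b0 hW hX hB hP; rewrite ler_pdivlMr//.
have := hW _ (P - 1%:M)^T; rewrite -trmx_mul !fnorm_tr.
have -> : W *m (P - 1%:M) = (X *m P - W) - (X - W) *m (P - 1%:M) - (X - W).
  by rewrite mulmxBl !mulmxBr !mulmx1; apply/matrixP => i j; rewrite !mxE; ring.
have := fnormB_le (X *m P - W - (X - W) *m (P - 1%:M)) (X - W).
have := fnormB_le (X *m P - W) ((X - W) *m (P - 1%:M)).
have := fnorm_mul (X - W) (P - 1%:M).
have := fnorm_ge0 (P - 1%:M); nra.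
Qed.

(** With [N = P - 1] the left side is the norm of [N^T N + N^T + N], and [p <= 1] makes the
    quadratic term no larger than the linear ones. *)
Lemma fnorm_gram_subid r (P : 'M[RR]_r) p :
  fnorm (P - 1%:M) <= p -> p <= 1 -> fnorm (P^T *m P - 1%:M) <= 3 * p.
Proof.
move=> hp p1.
have -> : P^T *m P - 1%:M
    = (P - 1%:M)^T *m (P - 1%:M) + (P - 1%:M)^T + (P - 1%:M).
  rewrite [(P - 1%:M)^T]raddfB/= trmx1 mulmxBl !mulmxBr !mulmx1 mul1mx.
  by apply/matrixP => i j; rewrite !mxE; ring.
have := fnormD_le ((P - 1%:M)^T *m (P - 1%:M) + (P - 1%:M)^T) (P - 1%:M).
have := fnormD_le ((P - 1%:M)^T *m (P - 1%:M)) (P - 1%:M)^T.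
have := fnorm_mul (P - 1%:M)^T (P - 1%:M).
rewrite !fnorm_tr; have := fnorm_ge0 (P - 1%:M) => f0.
have : fnorm (P - 1%:M) * fnorm (P - 1%:M) <= fnorm (P - 1%:M).
  by rewrite ler_piMr//; lra.
lra.
Qed.

(** One block of a gradient step seen in aligned coordinates: [L] is the defect of the Gram matrix
    of the alignment. Since [l <= 1], the direction [G + G L] has norm at most twice that of [G],
    whence the 4. *)
Lemma fnorm_half_step m r (A G : 'M[RR]_(m, r)) (L : 'M_r) h l :
  0 <= h -> l <= 1 -> fnorm L <= l ->
  fnorm (A - h *: (G + G *m L)) ^+ 2 <=
  fnorm A ^+ 2 - 2 * h * ip A G + 2 * h * (l * fnorm A * fnorm G)
  + 4 * h ^+ 2 * fnorm G ^+ 2.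
Proof.
move=> h0 l1 hL; rewrite fnormB_sqr fnormZ ger0_norm// ipZr ipDr.
have GL : fnorm (G *m L) <= l * fnorm G.
  by rewrite (le_trans (fnorm_mul _ _))// mulrC ler_wpM2r ?fnorm_ge0.
have h1 : - (l * fnorm A * fnorm G) <= ip A (G *m L).
  apply: le_trans (ip_ge _ _); rewrite lerN2.
  have : fnorm A * fnorm (G *m L) <= fnorm A * (l * fnorm G).
    by rewrite ler_wpM2l ?fnorm_ge0.
  lra.
have h2 : fnorm (G + G *m L) ^+ 2 <= (2 * fnorm G) ^+ 2.
  rewrite ler_pXn2r ?nnegrE ?mulr_ge0 ?fnorm_ge0//.
  have := fnormD_le G (G *m L); have := fnorm_ge0 G; nra.
have h3 : h * - (l * fnorm A * fnorm G) <= h * ip A (G *m L) by rewrite ler_wpM2l.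
have h4 : h ^+ 2 * fnorm (G + G *m L) ^+ 2 <= h ^+ 2 * (2 * fnorm G) ^+ 2.
  by rewrite ler_wpM2l ?sqr_ge0.
rewrite exprMn; lra.
Qed.

(** Continuity in [t] at [d]. It turns estimates for alignments of misfit below [t], for every [t]
    just above [dist], into estimates for [dist] itself. *)
Lemma le_sqr_lim (A K d T : RR) : 0 <= A -> 0 < K -> 0 <= d -> d < T ->
  (forall t, d < t -> t <= T -> A <= K * t ^+ 2) -> A <= K * d ^+ 2.
Proof.
move=> A0 K0 d0 dT h; rewrite leNgt; apply/negP => hd.
pose s := Num.sqrt (A / K).
have AK : A = K * s ^+ 2.
  by rewrite sqr_sqrtr ?divr_ge0 ?(ltW K0)// mulrC divfK// gt_eqF.
have ds : d < s.
  by move: hd; rewrite AK ltr_pM2l// ltr_pXn2r ?nnegrE// sqrtr_ge0.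
(* If the claim failed, [d < s]; a point strictly between them and at most [T] contradicts the
   hypothesis. *)
pose t := Num.min T ((d + s) / 2).
have dt : d < t by rewrite lt_min dT/=; lra.
have ts : t < s by rewrite gt_min; apply/orP; right; lra.
have tT : t <= T by rewrite ge_min lexx.
have := h t dt tT; rewrite AK ler_pM2l// ler_pXn2r ?nnegrE//; last 2 first.
- exact: sqrtr_ge0.
- by rewrite ltW// (le_lt_trans d0).
by rewrite leNgt ts.
Qed.

(** * One gradient step near the balanced factorization *)

Section Factorization.
Context {n1 n2 r : nat} (U : 'M[RR]_(n1, r)) (V : 'M[RR]_(n2, r)).
Context (d : 'rV[RR]_r) (a b : RR).
Context (UU : U^T *m U = 1%:M) (VV : V^T *m V = 1%:M).
Context (b0 : 0 < b) (ba : b <= a) (hd : forall i, b <= d 0 i <= a).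

Local Notation D := (diag_mx d).
Local Notation Xs := (U *m D).
Local Notation Ys := (V *m D).
Local Notation M := (Xs *m Ys^T).
Implicit Types (X : 'M[RR]_(n1, r)) (Y : 'M[RR]_(n2, r)) (P : 'M[RR]_r).

Lemma op_le_factor m (W : 'M[RR]_(m, r)) :
  W^T *m W = 1%:M -> op_le (W *m D) a.
Proof.
move=> WW; have a0 : 0 <= a by move: (b0) (ba); lra.
rewrite -(mulr1 a); apply: op_le_mul => //; first exact: op_le_isom.
by move=> p A; have /andP[] := fnorm_mul_diag A (ltW b0) hd.
Qed.

Lemma factor_lower m (W : 'M[RR]_(m, r)) : W^T *m W = 1%:M ->
  forall p (A : 'M_(p, r)), b * fnorm A <= fnorm (A *m (W *m D)^T).
Proof.
move=> WW p A; rewrite trmx_mul tr_diag_mx mulmxA fnorm_mul_isom//.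
by have /andP[] := fnorm_mul_diag A (ltW b0) hd.
Qed.

Lemma mulmx_aligned X Y P : P \in unitmx ->
  (X *m P) *m (Y *m (invmx P)^T)^T = X *m Y^T.
Proof. by move=> uP; rewrite trmx_mul trmxK mulmxA mulmxK. Qed.

Lemma residual_split (x : 'M[RR]_(n1, r)) (y : 'M[RR]_(n2, r)) :
  x *m y^T - M = Xs *m (y - Ys)^T + (x - Xs) *m y^T.
Proof.
by rewrite [(y - _)^T]raddfB/= mulmxBr mulmxBl [RHS]addrC addrA subrK.
Qed.

Let a0 : 0 <= a.
Proof. by move: (b0) (ba); lra. Qed.

(** In [residual_split] the first term costs [a t], and the second [(a + t) t <= 2 a t], because the
    aligned [y] has spectral norm at most [a + t]. *)
Lemma residual_le X Y P t : P \in unitmx -> gap X Y Xs Ys P <= t -> t <= a ->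
  fnorm (X *m Y^T - M) <= 3 * a * t.
Proof.
move=> uP ht ta; rewrite -(mulmx_aligned X Y uP).
have := le_trans (fnorm_gapl X Y Xs Ys P) ht.
have := le_trans (fnorm_gapr X Y Xs Ys P) ht.
move: (X *m P) (Y *m _^T) => x y hy hx.
rewrite residual_split.
have t0 : 0 <= t := le_trans (fnorm_ge0 _) hy.
have hopy : op_le y^T (a + t).
  apply: op_le_tr; first exact: addr_ge0.
  exact: op_le_near (op_le_factor VV) hy.
have := hopy _ (x - Xs).
have := fnorm_mul_opl (y - Ys)^T a0 (op_le_factor UU); rewrite fnorm_tr.
have := fnormD_le (Xs *m (y - Ys)^T) ((x - Xs) *m y^T).
have := fnorm_ge0 (x - Xs); have := fnorm_ge0 (y - Ys); have := a0; nra.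
Qed.

(* Take [P] with [U^T X P = D]: then [U^T] kills [X P - Xs], so the two summands of
   [X Y^T - M = Xs (Y P^-T - Ys)^T + (X P - Xs) (Y P^-T)^T] are orthogonal. *)
Lemma dist_le_residual X Y P0 : P0 \in unitmx -> gap X Y Xs Ys P0 < b ->
  2 * fnorm (X *m Y^T - M) <= b ^+ 2 ->
  b * dist X Y Xs Ys <= 2 * fnorm (X *m Y^T - M).
Proof.
move=> uP0 hgap hE.
have uD : D \in unitmx.
  apply: (unitmx_bounded_below b0) => v.
  by have /andP[] := fnorm_mul_diag v (ltW b0) hd.
(* Times [P0] this matrix is [D + G], where [G] is smaller than [b] and [D] is bounded below by
   [b]. *)
have uUX : U^T *m X \in unitmx.
  suff : U^T *m X *m P0 \in unitmx by rewrite unitmx_mul => /andP[].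
  pose G := U^T *m (X *m P0 - Xs).
  have -> : U^T *m X *m P0 = D + G.
    by rewrite /G mulmxBr !mulmxA UU mul1mx addrC subrK.
  have hG : fnorm G <= gap X Y Xs Ys P0.
    apply: le_trans (fnorm_gapl X Y Xs Ys P0).
    rewrite -[leRHS]mul1r; apply: fnorm_mul_opl => //.
    by apply: op_le_tr => //; exact: op_le_isom.
  apply: (@unitmx_bounded_below _ _ (b - gap X Y Xs Ys P0)); first by rewrite subr_gt0.
  move=> v; rewrite mulmxDr.
  have /andP[h _] := fnorm_mul_diag v (ltW b0) hd.
  have := fnormB_le (v *m D + v *m G) (v *m G); rewrite addrK.
  have := fnorm_mul v G; have := fnorm_ge0 v; nra.
pose P := invmx (U^T *m X) *m D.
have uP : P \in unitmx by rewrite unitmx_mul unitmx_inv uUX.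
have UXP : U^T *m (X *m P) = D by rewrite mulmxA mulKVmx.
have := dist_le_gap X Y Xs Ys uP; have := gap_sqr X Y Xs Ys P.
have := gap_ge0 X Y Xs Ys P; have := dist_ge0 X Y Xs Ys.
move: hE; rewrite -(mulmx_aligned X Y uP).
move: (gap _ _ _ _ P) (X *m P) (Y *m _^T) UXP => g x y UX.
have Udx : U^T *m (x - Xs) = 0 by rewrite mulmxBr UX mulmxA UU mul1mx subrr.
rewrite residual_split.
set E := _ + _ => hE d0 g0 gE dg.
have EE : fnorm E ^+ 2 = fnorm (Xs *m (y - Ys)^T) ^+ 2 + fnorm ((x - Xs) *m y^T) ^+ 2.
  rewrite fnormD_sqr; suff -> : ip (Xs *m (y - Ys)^T) ((x - Xs) *m y^T) = 0.
    by rewrite mulr0 addr0.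
  by rewrite ipC -[Xs *m _]mulmxA ip_mull mulmxA Udx mul0mx /ip mul0mx mxtrace0.
have hy : b * fnorm (y - Ys) <= fnorm (Xs *m (y - Ys)^T).
  by rewrite -(fnorm_tr (_ *m _)) trmx_mul trmxK; exact: factor_lower.
have hx : b * fnorm (x - Xs) <= fnorm ((x - Xs) *m y^T) + fnorm (x - Xs) * fnorm (y - Ys).
  apply: le_trans (factor_lower VV _) _.
  have -> : (x - Xs) *m Ys^T = (x - Xs) *m y^T - (x - Xs) *m (y - Ys)^T.
    by rewrite [(y - _)^T]raddfB/= -mulmxBr subKr.
  by rewrite (le_trans (fnormB_le _ _))// lerD2l -(fnorm_tr (y - Ys)) fnorm_mul.
have := fnorm_ge0 (x - Xs); have := fnorm_ge0 (y - Ys); have := fnorm_ge0 E.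
have := fnorm_ge0 (Xs *m (y - Ys)^T); have := fnorm_ge0 ((x - Xs) *m y^T).
move: hE d0 g0 gE dg EE hx hy.
move: (fnorm E) (fnorm (Xs *m _)) (fnorm (_ *m y^T)) (fnorm (x - _)) (fnorm (y - _)) (dist _ _ _ _)
  => e u v dx dy q hE d0 g0 gE dg EE hx hy v0 u0 e0 dy0 dx0.
have bb := b0.
have ue : u <= e by rewrite -(@ler_pXn2r _ 2)//; have := sqr_ge0 v; lra.
(* From [b dy <= u <= e] and [2 e <= b^2]. The product [dx dy] in [hx] is then at most [b dx / 2]
   and is absorbed, at the cost of a factor 2 on [v]. *)
have dyb : 2 * dy <= b by rewrite -(ler_pM2l bb); nra.
have hx' : b * dx <= 2 * v by nra.
have : (b * g) ^+ 2 <= (2 * e) ^+ 2.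
  have h1 : (b * dy) ^+ 2 <= u ^+ 2 by rewrite ler_pXn2r ?nnegrE// mulr_ge0// ltW.
  have h2 : (b * dx) ^+ 2 <= (2 * v) ^+ 2.
    by rewrite ler_pXn2r ?nnegrE// mulr_ge0// ltW.
  move: h1 h2; rewrite !exprMn gE EE; have := sqr_ge0 u; lra.
rewrite ler_pXn2r ?nnegrE ?mulr_ge0 ?(ltW bb)//.
by apply: le_trans; rewrite ler_pM2l.
Qed.

(** In the coordinates [x = X P] and [y = Y P^-T] the update is the plain gradient step up to the
    right factors [P^T P] and its inverse, both within [l] of the identity. Both blocks are expanded
    by [fnorm_half_step]; [g <= a] keeps the spectral norms of [x] and [y] below [2 a]. *)
Lemma gap_step X Y P h l (E := X *m Y^T - M) (g := gap X Y Xs Ys P) :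
  P \in unitmx -> 0 <= h -> l <= 1 -> g <= a ->
  fnorm (P^T *m P - 1%:M) <= l ->
  fnorm (((invmx P)^T)^T *m (invmx P)^T - 1%:M) <= l ->
  gap (X - h *: (E *m Y)) (Y - h *: (E^T *m X)) Xs Ys P ^+ 2 <=
  g ^+ 2 - 2 * h * fnorm E ^+ 2 + 2 * h * fnorm E * g ^+ 2
  + 8 * h * a * l * g * fnorm E + 32 * h ^+ 2 * a ^+ 2 * fnorm E ^+ 2.
Proof.
move=> uP h0 l1 ga hl1 hl2.
set Q := (invmx P)^T; set x := X *m P; set y := Y *m Q.
have Yy : Y = y *m P^T by rewrite /y /Q -mulmxA -trmx_mul mulmxV// trmx1 mulmx1.
have Xx : X = x *m Q^T by rewrite /x /Q trmxK mulmxK.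
have hx : fnorm (x - Xs) <= g by exact: fnorm_gapl.
have hy : fnorm (y - Ys) <= g by exact: fnorm_gapr.
have gE : g ^+ 2 = fnorm (x - Xs) ^+ 2 + fnorm (y - Ys) ^+ 2 by exact: gap_sqr.
have g0 : 0 <= g by exact: gap_ge0.
have EE : E = x *m y^T - M by rewrite /E -(mulmx_aligned X Y uP).
rewrite gap_sqr -/Q.
have -> : (X - h *: (E *m Y)) *m P - Xs
    = (x - Xs) - h *: (E *m y + E *m y *m (P^T *m P - 1%:M)).
  rewrite mulmxBl -/x addrAC -scalemxAl mulmxBr mulmx1 [E *m y + _]addrC subrK.
  by rewrite {1}Yy !mulmxA.
have -> : (Y - h *: (E^T *m X)) *m Q - Ys
    = (y - Ys) - h *: (E^T *m x + E^T *m x *m (Q^T *m Q - 1%:M)).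
  rewrite mulmxBl -/y addrAC -scalemxAl mulmxBr mulmx1 [E^T *m x + _]addrC subrK.
  by rewrite {1}Xx !mulmxA.
have opx : op_le x (a + a) by apply: op_le_near (op_le_factor UU) (le_trans hx ga).
have opy : op_le y (a + a) by apply: op_le_near (op_le_factor VV) (le_trans hy ga).
have s1 := fnorm_half_step (x - Xs) (E *m y) h0 l1 hl1.
have s2 := fnorm_half_step (y - Ys) (E^T *m x) h0 l1 hl2.
(* The two linear terms pair [E] with [x (y - Ys)^T + (x - Xs) y^T], which equals
   [E + (x - Xs) (y - Ys)^T]; the last product is of second order in [g]. *)
have cross : ip (x - Xs) (E *m y) + ip (y - Ys) (E^T *m x)
    = fnorm E ^+ 2 + ip ((x - Xs) *m (y - Ys)^T) E.
  have -> : ip (y - Ys) (E^T *m x) = ip (x *m (y - Ys)^T) E.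
    by rewrite ip_mull trmxK ipC ip_mulr.
  rewrite ip_mulr -ipDl fnorm_sqr -ipDl; congr (ip _ _).
  rewrite EE [(y - Ys)^T]raddfB/= !mulmxBl !mulmxBr.
  by apply/matrixP => i j; rewrite !mxE; ring.
have hxy : fnorm ((x - Xs) *m (y - Ys)^T) <= g ^+ 2.
  rewrite (le_trans (fnorm_mul _ _))// fnorm_tr expr2.
  by apply: ler_pM; rewrite ?fnorm_ge0.
have := ip_ge ((x - Xs) *m (y - Ys)^T) E.
have Gy : fnorm (E *m y) <= 2 * a * fnorm E by have := opy _ E; lra.
have Gx : fnorm (E^T *m x) <= 2 * a * fnorm E.
  by have := opx _ E^T; rewrite fnorm_tr; lra.
have := fnorm_ge0 E; have := fnorm_ge0 (x - Xs); have := fnorm_ge0 (y - Ys).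
have := fnorm_ge0 (E *m y); have := fnorm_ge0 (E^T *m x); move: cross s1 s2 gE.
have l0 : 0 <= l := le_trans (fnorm_ge0 _) hl1.
have aa := a0; clear -hx hy g0 hxy Gy Gx l0 h0 aa.
move: (ip (x - Xs) _) (ip (y - Ys) _) (ip _ E) => i1 i2 i3.
move: (fnorm (_ - _ - _)) (fnorm (y - Ys - _)) => n1' n2'.
move: (fnorm (E^T *m x)) (fnorm (E *m y)) (fnorm (_ *m _))
  (fnorm (x - _)) (fnorm (y - _)) (fnorm E) hx hy hxy Gy Gx.
move=> gx gy dxy dx dy e hx hy hxy Gy Gx cross s1 s2 gE gx0 gy0 dy0 dx0 e0 ipge.
have h1 : l * dx * gy <= l * g * (2 * a * e).
  by apply: ler_pM; rewrite ?mulr_ge0//; apply: ler_wpM2l.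
have h2 : l * dy * gx <= l * g * (2 * a * e).
  by apply: ler_pM; rewrite ?mulr_ge0//; apply: ler_wpM2l.
have h3 : gy ^+ 2 <= (2 * a * e) ^+ 2 by rewrite ler_pXn2r ?nnegrE ?mulr_ge0.
have h4 : gx ^+ 2 <= (2 * a * e) ^+ 2 by rewrite ler_pXn2r ?nnegrE ?mulr_ge0.
have h5 : - (g ^+ 2 * e) <= i3.
  by apply: le_trans ipge; rewrite lerN2 ler_wpM2r.
have h6 : h * (l * dx * gy + l * dy * gx) <= h * (2 * (l * g * (2 * a * e))).
  by rewrite ler_wpM2l//; lra.
have h7 : h ^+ 2 * (gx ^+ 2 + gy ^+ 2) <= h ^+ 2 * (2 * (2 * a * e) ^+ 2).
  by rewrite ler_wpM2l ?sqr_ge0//; lra.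
have h8 : h * (e ^+ 2 - g ^+ 2 * e) <= h * (i1 + i2) by rewrite ler_wpM2l//; lra.
lra.
Qed.

Lemma dist_step X Y h B :
  0 < h -> 64 * (h * a ^+ 2) <= 1 ->
  fnorm (X - Xs) <= B -> fnorm (Y - Ys) <= B -> 240 * (a * B) <= b ^+ 2 ->
  240 * (a * dist X Y Xs Ys) < b ^+ 2 ->
  dist (X - h *: ((X *m Y^T - M) *m Y)) (Y - h *: ((X *m Y^T - M)^T *m X)) Xs Ys ^+ 2
    <= (1 - h * b ^+ 2 / 8) * dist X Y Xs Ys ^+ 2.
Proof.
move=> h0 ha hX hY hB hd'; have bb := b0; have aa := a0; have ab := ba.
have ap : 0 < a by lra.
have B0 : 0 <= B := le_trans (fnorm_ge0 _) hX.
set E := X *m Y^T - M; set X' := X - _; set Y' := Y - _.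
(* [T] is the largest misfit at which the constant 240 still controls the alignment. *)
set q := dist X Y Xs Ys; pose T := b ^+ 2 / (240 * a).
have qT : q < T by rewrite ltr_pdivlMr ?mulr_gt0//; rewrite -/q in hd'; lra.
(* The decrease is available in terms of [q], the errors only in terms of [t > q]. With the decrease
   moved to the left, the right side can be proved with [t] for [q] and passed to the limit; the net
   factor is [1/8 - 1/4]. *)
suff : dist X' Y' Xs Ys ^+ 2 + h * b ^+ 2 / 4 * q ^+ 2 <= (1 + h * b ^+ 2 / 8) * q ^+ 2.
  lra.
have hb : 0 < h * b ^+ 2 by rewrite mulr_gt0// exprn_gt0.
apply: (@le_sqr_lim _ _ _ T) => //.
- by rewrite addr_ge0 ?sqr_ge0// mulr_ge0 ?sqr_ge0//; lra.
- lra.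
- exact: dist_ge0.
move=> t qt tT; have [P uP gt] := gap_lt qt.
have taT : 240 * (a * t) <= b ^+ 2.
  by move: tT; rewrite /T ler_pdivlMr ?mulr_gt0//; lra.
have g0 := gap_ge0 X Y Xs Ys P.
have t0 : 0 <= t by lra.
have tb : 240 * t <= b.
  have h1 : b * (240 * t) <= a * (240 * t) by rewrite ler_wpM2r//; lra.
  rewrite -(ler_pM2l bb); lra.
have Bb : 240 * B <= b.
  have h1 : b * (240 * B) <= a * (240 * B) by rewrite ler_wpM2r//; lra.
  rewrite -(ler_pM2l bb); lra.
(* The bound of [fnorm_subid_near] for both [P] and its inverse transpose; the constant 240 makes
   [a p <= b / 60]. *)
pose p := 2 * (t + B) / b.
have hp : 60 * (a * p) <= b.
  by rewrite /p !mulrA ler_pdivrMr//; lra.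
have p1 : p <= 1 by rewrite /p ler_pdivrMr//; lra.
have p0 : 0 <= p by rewrite /p divr_ge0 ?(ltW bb)//; lra.
have P1 : fnorm (P - 1%:M) <= p.
  apply: (@fnorm_subid_near _ _ X Xs) => //; try lra; first exact: factor_lower.
  by apply: le_trans (fnorm_gapl X Y Xs Ys P) _; exact: ltW.
have Q1 : fnorm ((invmx P)^T - 1%:M) <= p.
  apply: (@fnorm_subid_near _ _ Y Ys) => //; try lra; first exact: factor_lower.
  by apply: le_trans (fnorm_gapr X Y Xs Ys P) _; exact: ltW.
have p3 : 3 * p <= 1.
  by rewrite /p mulrA ler_pdivrMr//; lra.
have ga : gap X Y Xs Ys P <= a by lra.
have st := gap_step uP (ltW h0) p3 ga (fnorm_gram_subid P1 p1) (fnorm_gram_subid Q1 p1).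
have ta : t <= a by lra.
have He : fnorm E <= 3 * a * t by apply: residual_le uP (ltW gt) ta.
have Hd : b * q <= 2 * fnorm E.
  apply: (dist_le_residual uP); rewrite -/E; have := sqr_ge0 b; lra.
have Hn := dist_le_gap X' Y' Xs Ys uP.
have Hn2 : dist X' Y' Xs Ys ^+ 2 <= gap X' Y' Xs Ys P ^+ 2.
  by rewrite ler_pXn2r ?nnegrE ?dist_ge0 ?gap_ge0.
apply: le_trans (lerD Hn2 (lexx _)) _.
apply: le_trans (lerD st (lexx _)) _.
have e0 := fnorm_ge0 E; have q0 := dist_ge0 X Y Xs Ys.
rewrite -/E -/q; move: q0; rewrite -/q.
move: (fnorm E) (gap X Y Xs Ys P) q gt g0 He Hd e0 {hd' qT qt st ga uP X' Y' Hn Hn2 P1 Q1}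
  => e g q gt g0 He Hd e0 q0.
have h1 : b ^+ 2 * q ^+ 2 <= 4 * e ^+ 2.
  have : (b * q) ^+ 2 <= (2 * e) ^+ 2 by rewrite ler_pXn2r ?nnegrE ?mulr_ge0// ltW.
  by rewrite !exprMn; lra.
have h2 : h * (b ^+ 2 * q ^+ 2) <= h * (4 * e ^+ 2) by rewrite ler_pM2l.
have h3 : 64 * (h * a ^+ 2) * (h * e ^+ 2) <= h * e ^+ 2.
  by rewrite ler_piMl// mulr_ge0 ?sqr_ge0// ltW.
have h4 : h * (g ^+ 2) * b ^+ 2 <= h * b ^+ 2 * t ^+ 2.
  by rewrite mulrAC ler_pM2l// ler_pXn2r ?nnegrE//; lra.
have h5 : g ^+ 2 <= t ^+ 2 by rewrite ler_pXn2r ?nnegrE//; lra.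
have he0 : 0 <= h * e by rewrite mulr_ge0// ltW.
(* The error terms are at most [h e g b / 2 <= h e^2 / 2 + h b^2 g^2 / 8]. *)
have h6 : (h * e) * (g * (2 * g + 8 * (a * (3 * p)))) <= (h * e) * (g * (b / 2)).
  by rewrite ler_wpM2l// ler_wpM2l//; lra.
have h7 : 0 <= h * (e - b * g / 2) ^+ 2 by rewrite mulr_ge0 ?sqr_ge0// ltW.
(* Of the gain [2 h e^2], the term quadratic in [h] uses at most [h e^2 / 2], the decrease moved to
   the left [h e^2], and the errors the remaining [h e^2 / 2], leaving [h b^2 g^2 / 8]. *)
nra.
Qed.

(** Passing to the infimum in [residual_le] bounds the residual by [3 a] times the distance, and [X]
    and [Y] have spectral norm at most [2 a]. The bound concerns the unaligned iterates and controls
    their drift. *)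
Lemma gd_increment_le X Y h :
  0 <= h -> fnorm (X - Xs) <= a -> fnorm (Y - Ys) <= a -> dist X Y Xs Ys < a ->
  fnorm (h *: ((X *m Y^T - M) *m Y)) <= 6 * (h * a ^+ 2) * dist X Y Xs Ys /\
  fnorm (h *: ((X *m Y^T - M)^T *m X)) <= 6 * (h * a ^+ 2) * dist X Y Xs Ys.
Proof.
move=> h0 hX hY qa; have bb := b0; have ab := ba; have ap : 0 < a by lra.
set E := X *m Y^T - M; set q := dist X Y Xs Ys.
have hE : fnorm E <= 3 * a * q.
  suff : fnorm E ^+ 2 <= (3 * a) ^+ 2 * q ^+ 2.
    rewrite -exprMn ler_pXn2r ?nnegrE ?fnorm_ge0// mulr_ge0 ?dist_ge0//; lra.
  apply: (@le_sqr_lim _ _ _ a) => //.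
  - exact: sqr_ge0.
  - by rewrite exprn_gt0//; lra.
  - exact: dist_ge0.
  move=> t qt ta; have [P uP gt] := gap_lt qt.
  have t0 : 0 <= t by have := gap_ge0 X Y Xs Ys P; lra.
  rewrite -exprMn ler_pXn2r ?nnegrE ?fnorm_ge0//; last by rewrite mulr_ge0//; lra.
  exact: residual_le uP (ltW gt) ta.
have opx : op_le X (a + a) by apply: op_le_near (op_le_factor UU) hX.
have opy : op_le Y (a + a) by apply: op_le_near (op_le_factor VV) hY.
rewrite !fnormZ !ger0_norm//; split.
- have h1 := opy _ E.
  have : (a + a) * fnorm E <= (a + a) * (3 * a * q) by rewrite ler_wpM2l//; lra.
  move=> h2; have : h * fnorm (E *m Y) <= h * ((a + a) * (3 * a * q)) by rewrite ler_wpM2l//; lra.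
  lra.
- have h1 := opx _ E^T; rewrite fnorm_tr in h1.
  have : (a + a) * fnorm E <= (a + a) * (3 * a * q) by rewrite ler_wpM2l//; lra.
  move=> h2; have : h * fnorm (E^T *m X) <= h * ((a + a) * (3 * a * q)) by rewrite ler_wpM2l//; lra.
  lra.
Qed.

End Factorization.

(** * Equivariance under rotations *)

Lemma orthogonal_tr r (Q : 'M[RR]_r) : Defs.orthogonal Q -> Defs.orthogonal Q^T.
Proof. by move=> /mulmx1C QQ; rewrite /Defs.orthogonal trmxK. Qed.

Lemma orthogonal_unit r (Q : 'M[RR]_r) : Defs.orthogonal Q -> Q \in unitmx.
Proof. by case/mulmx1_unit. Qed.

Lemma orthogonal_invmx r (Q : 'M[RR]_r) : Defs.orthogonal Q -> invmx Q = Q^T.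
Proof.
move=> QQ; rewrite -[LHS]mul1mx -QQ mulmxK//; exact: orthogonal_unit.
Qed.

Section Rotation.
Context {n1 n2 r : nat} (Q : 'M[RR]_r) (QQ : Defs.orthogonal Q).
Implicit Types (X : 'M[RR]_(n1, r)) (Y : 'M[RR]_(n2, r)).

Lemma gap_mul_orthogonal X Y Xs Ys P : P \in unitmx ->
  gap (X *m Q) (Y *m Q) Xs Ys P = gap X Y Xs Ys (Q *m P).
Proof.
move=> uP; have uQP : Q *m P \in unitmx by rewrite unitmx_mul orthogonal_unit.
suff QP : invmx (Q *m P) = invmx P *m Q^T.
  by rewrite /gap QP trmx_mul trmxK !mulmxA.
rewrite -[RHS](mulKmx uQP) !mulmxA mulmxK//.
by rewrite -mulmxA (mulmx1C QQ) mulmx1.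
Qed.

Lemma dist_le_mul_orthogonal X Y Xs Ys :
  dist X Y Xs Ys <= dist (X *m Q) (Y *m Q) Xs Ys.
Proof.
rewrite leNgt; apply/negP => /gap_lt[P uP].
rewrite gap_mul_orthogonal// ltNge dist_le_gap//.
by rewrite unitmx_mul uP orthogonal_unit.
Qed.

End Rotation.

(** Multiplication by [Q] permutes the invertible alignments; the second inequality is the first one
    for [Q^T]. *)
Lemma dist_mul_orthogonal n1 n2 r (Q : 'M[RR]_r) (X : 'M[RR]_(n1, r))
  (Y : 'M[RR]_(n2, r)) Xs Ys : Defs.orthogonal Q ->
  dist (X *m Q) (Y *m Q) Xs Ys = dist X Y Xs Ys.
Proof.
move=> QQ; apply/le_anti/andP; split; last exact: dist_le_mul_orthogonal.
have := dist_le_mul_orthogonal (orthogonal_tr QQ) (X *m Q) (Y *m Q) Xs Ys.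
by rewrite -!mulmxA (mulmx1C QQ) !mulmx1.
Qed.

(** The product [X Y^T], hence the residual, is unchanged by a common rotation, so each step
    commutes with it. *)
Lemma gd_mul_orthogonal n1 n2 r h smax (M : 'M[RR]_(n1, n2)) (Q : 'M[RR]_r) X Y t :
  Defs.orthogonal Q ->
  gd h smax M (X *m Q) (Y *m Q) t =
  ((gd h smax M X Y t).1 *m Q, (gd h smax M X Y t).2 *m Q).
Proof.
move=> QQ; elim: t => [//|t /= ->].
case: (gd h smax M X Y t) => X1 Y1 /=.
have -> : X1 *m Q *m (Y1 *m Q)^T = X1 *m Y1^T.
  by rewrite trmx_mul mulmxA -(mulmxA X1) (mulmx1C QQ) mulmx1.
by rewrite !mulmxBl -!scalemxAl !mulmxBl !mulmxA.
Qed.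

(** An orthogonal matrix is its own inverse transpose. This links the initialization hypothesis to
    [dist]. *)
Lemma gap_orthogonal n1 n2 r (X Xs : 'M[RR]_(n1, r)) (Y Ys : 'M[RR]_(n2, r)) Q :
  Defs.orthogonal Q ->
  gap X Y Xs Ys Q = fnorm (col_mx X Y *m Q - col_mx Xs Ys).
Proof.
move=> QQ; rewrite /gap orthogonal_invmx// trmxK mul_col_mx opp_col_mx add_col_mx.
apply/eqP; rewrite -(@eqrXn2 _ 2)// ?sqrtr_ge0 ?fnorm_ge0//.
rewrite sqr_sqrtr ?addr_ge0 ?sqr_ge0// !fnorm_sqr.
by rewrite /ip tr_col_mx mul_col_row mxtrace_block.
Qed.

(** * Extreme singular values *)

Section SingularValues.
Context {r : nat} (s : 'rV[RR]_r).
Context (r0 : (0 < r)%N) (s0 : forall i, 0 < s 0 i).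

Lemma sigma_bounds i : sigma_min s <= s 0 i <= sigma_max s.
Proof.
apply/andP; split.
  by rewrite /sigma_min (bigD1 i)//= ge_min lexx.
by rewrite /sigma_max (bigD1 i)//= le_max lexx.
Qed.

Lemma sigma_max_gt0 : 0 < sigma_max s.
Proof.
by have /andP[_] := sigma_bounds (Ordinal r0); apply: lt_le_trans.
Qed.

Lemma sigma_min_gt0 : 0 < sigma_min s.
Proof.
(* The starting value of the minimum is [sigma_max s], positive because there is an index. *)
rewrite /sigma_min; elim/big_ind: _ => //; first exact: sigma_max_gt0.
by move=> x y x0 y0; rewrite lt_min x0.
Qed.

Lemma sigma_min_le_max : sigma_min s <= sigma_max s.
Proof. by have /andP[h1 h2] := sigma_bounds (Ordinal r0); exact: le_trans h2. Qed.

End SingularValues.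

(** * Induction along the iterates *)

(** Side conditions of [dist_step] and [gd_increment_le], with [rt] in the role of [rho ^+ t]. As
    [rt >= 0], the radius [B] never exceeds [301 k delta], and [240 * 301 < 150 * 1000]. *)
Lemma gd_radius_bounds (a b k delta rt q : RR) (B := delta + 300 * k * delta * (1 - rt)) :
  0 < b -> b <= a -> 1 <= k -> 150 * 1000 * (a * (k * delta)) <= b ^+ 2 ->
  0 <= delta -> 0 <= rt -> rt <= 1 -> q <= delta ->
  [/\ 240 * (a * B) <= b ^+ 2, B <= a, 240 * (a * q) < b ^+ 2 & q < a].
Proof.
move=> b0 ba k1 hdel d0 rt0 rt1 qd.
have a0 : 0 < a := lt_le_trans b0 ba.
have kd : delta <= k * delta by rewrite ler_peMl.
have kd0 : 0 <= k * delta := le_trans d0 kd.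
have Bk : B <= 301 * (k * delta).
  have : 0 <= k * delta * rt by rewrite mulr_ge0.
  rewrite /B; lra.
have dB : delta <= B.
  rewrite /B lerDl -mulrA mulr_ge0//; last by rewrite mulr_ge0// subr_ge0.
  by rewrite mulr_ge0// (le_trans _ k1).
have b2 : 0 < b ^+ 2 by rewrite exprn_gt0.
clearbody B; have aB : 240 * (a * B) <= b ^+ 2.
  have : a * B <= a * (301 * (k * delta)) by rewrite ler_pM2l.
  have : 0 <= a * (k * delta) by rewrite mulr_ge0// ltW.
  clear -hdel; lra.
have aq : 240 * (a * q) < b ^+ 2.
  have : a * q <= a * (k * delta) by rewrite ler_pM2l// (le_trans qd).
  have : 0 <= a * (k * delta) by rewrite mulr_ge0// ltW.
  clear -hdel b2; lra.
have Ba : 240 * B <= b.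
  rewrite -(ler_pM2l b0) -expr2; apply: le_trans aB; clear hdel.
  have : b * B <= a * B by rewrite ler_wpM2r// (le_trans d0).
  lra.
by clear hdel; split=> //; lra.
Qed.

Section Convergence.
Context {n1 n2 r : nat} (U : 'M[RR]_(n1, r)) (V : 'M[RR]_(n2, r)).
Context (d : 'rV[RR]_r) (a b eta : RR).
Context (UU : U^T *m U = 1%:M) (VV : V^T *m V = 1%:M).
Context (b0 : 0 < b) (ba : b <= a) (hd : forall i, b <= d 0 i <= a).
Context (eta0 : 0 < eta) (eta_le : 64 * eta <= 1).

Local Notation Xs := (U *m diag_mx d).
Local Notation Ys := (V *m diag_mx d).
Local Notation M := (Xs *m Ys^T).
Local Notation rho := (1 - eta / (50 * (a ^+ 2 / b ^+ 2))).

(** The three bounds are proved together: contraction needs the iterates near [Xs] and [Ys], and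
    nearness follows from summing the contracting increments. The radius is the closed form of that
    geometric sum. *)
Lemma gd_linear_convergence X0 Y0 (delta : RR) :
  150 * 1000 * (a ^+ 3 * delta) <= b ^+ 4 ->
  fnorm (X0 - Xs) <= delta -> fnorm (Y0 - Ys) <= delta ->
  dist X0 Y0 Xs Ys <= delta ->
  let X t := (gd eta (a ^+ 2) M X0 Y0 t).1 in
  let Y t := (gd eta (a ^+ 2) M X0 Y0 t).2 in
  forall t,
  [/\ fnorm (X t - Xs) <= delta + 300 * (a ^+ 2 / b ^+ 2) * delta * (1 - rho ^+ t),
      fnorm (Y t - Ys) <= delta + 300 * (a ^+ 2 / b ^+ 2) * delta * (1 - rho ^+ t)
    & dist (X t) (Y t) Xs Ys <= rho ^+ t * dist X0 Y0 Xs Ys].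
Proof.
move=> hdel hX hY hdist X Y.
have bb := b0; have ab := ba; have ap : 0 < a by lra.
have del0 : 0 <= delta := le_trans (fnorm_ge0 _) hX.
set k := a ^+ 2 / b ^+ 2.
have kb : k * b ^+ 2 = a ^+ 2 by rewrite /k divfK// gt_eqF// exprn_gt0.
have k1 : 1 <= k.
  by rewrite /k ler_pdivlMr ?exprn_gt0// mul1r ler_pXn2r ?nnegrE// ltW.
have k0 : 0 < k by lra.
set rho := 1 - _.
have XS t : X t.+1 = X t - (eta / a ^+ 2) *: ((X t *m (Y t)^T - M) *m Y t).
  by rewrite /X /Y /=; case: (gd _ _ _ _ _ t).
have YS t : Y t.+1 = Y t - (eta / a ^+ 2) *: ((X t *m (Y t)^T - M)^T *m X t).
  by rewrite /X /Y /=; case: (gd _ _ _ _ _ t).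
have X0E : X 0%N = X0 by [].
have Y0E : Y 0%N = Y0 by [].
pose e := eta / (50 * k).
have ek : 50 * (e * k) = eta.
  by rewrite /e; field; rewrite gt_eqF.
have e0 : 0 < e.
  by apply: divr_gt0 => //; apply: mulr_gt0.
have e1 : e <= 1.
  have : e <= e * k by rewrite ler_peMr// ltW.
  by have := eta_le; lra.
have rhoE : rho = 1 - e by [].
clearbody X Y e rho k.
have kdel : 150 * 1000 * (a * (k * delta)) <= b ^+ 2.
  have b2 : 0 < b ^+ 2 by rewrite exprn_gt0.
  rewrite -(ler_pM2l b2).
  have -> : b ^+ 2 * (150 * 1000 * (a * (k * delta)))
      = 150 * 1000 * (a * (k * b ^+ 2) * delta) by ring.
  rewrite kb; apply: le_trans (_ : b ^+ 4 <= _).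
    by apply: le_trans hdel; rewrite le_eqVlt; apply/orP; left; apply/eqP; ring.
  by rewrite -exprD.
have rho0 : 0 <= rho by rewrite rhoE subr_ge0.
have rho1 : rho <= 1 by rewrite rhoE gerBl ltW.
(* One more term of the sum, since [6 eta = 300 k (1 - rho)]. *)
have radius_step z q : q <= z * delta ->
    delta + 300 * k * delta * (1 - z) + 6 * eta * q
    <= delta + 300 * k * delta * (1 - rho * z).
  move=> hq; have : 6 * eta * q <= 6 * eta * (z * delta).
    by rewrite ler_pM2l// mulr_gt0.
  by rewrite rhoE -ek; lra.
(* [dist_step] contracts the square by [1 - 50 e / 8], which is below [(1 - e)^2]; the slack is what
   allows the 50 in the rate. *)
have rate p q : 0 <= p -> 0 <= q -> p ^+ 2 <= (1 - 50 * e / 8) * q ^+ 2 -> p <= rho * q.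
  move=> p0 q0 hp; rewrite -(@ler_pXn2r _ 2) ?nnegrE ?mulr_ge0//.
  apply: le_trans hp _; rewrite exprMn ler_wpM2r ?sqr_ge0//.
  by rewrite rhoE; have := sqr_ge0 e; lra.
have hk : eta / a ^+ 2 * b ^+ 2 = 50 * e.
  by rewrite -ek -kb; field; rewrite !gt_eqF.
have q0 := dist_ge0 X0 Y0 Xs Ys.
elim=> [|t [hXt hYt hdt]].
  by rewrite X0E Y0E expr0 subrr mulr0 addr0 mul1r.
have rt0 : 0 <= rho ^+ t by exact: exprn_ge0.
have rt1 : rho ^+ t <= 1 by exact: exprn_ile1.
have dtd : dist (X t) (Y t) Xs Ys <= delta.
  exact: le_trans hdt (le_trans (ler_piMl q0 rt1) hdist).
have [aB Ba adt dta] := gd_radius_bounds bb ab k1 kdel del0 rt0 rt1 dtd.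
pose h := eta / a ^+ 2.
have a2 : 0 < a ^+ 2 by rewrite exprn_gt0.
have ha : h * a ^+ 2 = eta by rewrite /h divfK// gt_eqF.
have h0 : 0 < h by rewrite /h divr_gt0.
have XSt := XS t; have YSt := YS t; rewrite -/h in XSt YSt.
have [incX incY] := gd_increment_le UU VV b0 ba hd (ltW h0) (le_trans hXt Ba) (le_trans hYt Ba) dta.
have hh : 64 * (h * a ^+ 2) <= 1 by rewrite ha.
have st := dist_step UU VV b0 ba hd h0 hh hXt hYt aB adt.
rewrite -XSt -YSt in st.
set B := delta + _ in hXt hYt aB Ba.
have inc : B + 6 * (h * a ^+ 2) * dist (X t) (Y t) Xs Ys
    <= delta + 300 * k * delta * (1 - rho ^+ t.+1).
  rewrite ha exprS; apply: radius_step.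
  exact: le_trans hdt (ler_wpM2l rt0 hdist).
split.
- rewrite XSt addrAC (le_trans (fnormB_le _ _))//.
  exact: le_trans (lerD hXt incX) inc.
- rewrite YSt addrAC (le_trans (fnormB_le _ _))//.
  exact: le_trans (lerD hYt incY) inc.
rewrite hk in st; rewrite exprS -mulrA.
exact: le_trans (rate _ _ (dist_ge0 _ _ _ _) (dist_ge0 _ _ _ _) st) (ler_wpM2l rho0 hdt).
Qed.

End Convergence.

(** * Choice of constants and reduction to a rotated start *)

Theorem theorem2 :
  exists c0 : RR, exists eta : RR, 0 < c0 /\ 0 < eta /\
  forall (n1 n2 r : nat) (M : 'M[RR]_(n1, n2))
         (U : 'M[RR]_(n1, r)) (s : 'rV[RR]_r) (V : 'M[RR]_(n2, r)),
  (0 < r)%N -> \rank M = r -> compact_svd M U s V ->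
  forall (X0 : 'M[RR]_(n1, r)) (Y0 : 'M[RR]_(n2, r)),
  let Xs := U *m sqrt_diag s in
  let Ys := V *m sqrt_diag s in
  let k := kappa s in
  orth_dist (col_mx X0 Y0) (col_mx Xs Ys)
    <= c0 / (k * Num.sqrt k) * Num.sqrt (sigma_min s) ->
  forall t : nat,
  dist (gd eta (sigma_max s) M X0 Y0 t).1 (gd eta (sigma_max s) M X0 Y0 t).2 Xs Ys
    <= (1 - eta / (50 * k)) ^+ t * dist X0 Y0 Xs Ys.
Proof.
have small (x : RR) : 0 < x -> exists c, 0 < c /\ x * c <= 1.
  by move=> x0; exists x^-1; rewrite invr_gt0 x0 mulfV// gt_eqF.
have [eta [eta0 eta_le]] : exists eta : RR, 0 < eta /\ 64 * eta <= 1 by exact: small.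
have [c [c0 c_le]] : exists c : RR, 0 < c /\ 300 * 1000 * c <= 1.
  by apply: small; rewrite mulr_gt0.
exists c, eta; split=> //; split=> //.
move=> n1 n2 r M U s V r0 _ [UU VV s0 ->] X0 Y0 Xs Ys k hinit t.
pose a := Num.sqrt (sigma_max s); pose b := Num.sqrt (sigma_min s).
have smax0 := sigma_max_gt0 r0 s0; have smin0 := sigma_min_gt0 r0 s0.
have aE : a ^+ 2 = sigma_max s by rewrite sqr_sqrtr ?ltW.
have bE : b ^+ 2 = sigma_min s by rewrite sqr_sqrtr ?ltW.
have a0 : 0 < a by rewrite sqrtr_gt0.
have b0 : 0 < b by rewrite sqrtr_gt0.
have ba : b <= a by rewrite ler_sqrt ?sigma_min_le_max ?(ltW smax0).
pose d : 'rV[RR]_r := \row_i Num.sqrt (s 0 i).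
have hd i : b <= d 0 i <= a.
  have /andP[h1 h2] := sigma_bounds s i.
  by rewrite mxE !ler_sqrt ?h1 ?h2// ltW.
have ME : U *m diag_mx s *m V^T = Xs *m Ys^T.
  rewrite /Xs /Ys trmx_mul tr_diag_mx -!mulmxA; congr (_ *m _).
  rewrite !mulmxA; congr (_ *m _); rewrite mulmx_diag; congr diag_mx.
  by apply/rowP => i; rewrite !mxE -expr2 sqr_sqrtr ?ltW.
have kE : k = a ^+ 2 / b ^+ 2 by rewrite /k /kappa aE bE.
have sk : Num.sqrt k = a / b.
  by rewrite kE -expr_div_n sqrtr_sqr ger0_norm// divr_ge0// ltW.
(* The hypothesis bounds the infimum by [c b^4 / a^3]. Doubling makes the inequality strict, so some
   orthogonal [Q] has misfit below [delta] even if the infimum is not attained; the 2 turns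
   [300 * 1000] into [150 * 1000]. *)
pose delta := 2 * (c * (b ^+ 4 / a ^+ 3)).
have del0 : 0 < delta by rewrite /delta !mulr_gt0 ?invr_gt0 ?exprn_gt0.
have {}hinit : orth_dist (col_mx X0 Y0) (col_mx Xs Ys) < delta.
  apply: le_lt_trans hinit _; rewrite sk kE -/b.
  have -> : c / (a ^+ 2 / b ^+ 2 * (a / b)) * b = delta / 2.
    by rewrite /delta; field; rewrite !gt_eqF.
  by rewrite ltr_pdivrMr// ltr_pMr// ltr1n.
have [_ [Q [QQ ->]]] : exists2 x, (exists Q : 'M[RR]_r, Defs.orthogonal Q /\
    x = fnorm (col_mx X0 Y0 *m Q - col_mx Xs Ys)) & x < delta.
  apply: inf_lt hinit; exists (fnorm (col_mx X0 Y0 *m 1%:M - col_mx Xs Ys)), 1%:M.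
  by rewrite /Defs.orthogonal trmx1 mulmx1.
rewrite -gap_orthogonal// => hQ.
have hX : fnorm (X0 *m Q - Xs) <= delta.
  exact: le_trans (fnorm_gapl _ Y0 _ Ys _) (ltW hQ).
have hY : fnorm (Y0 *m Q - Ys) <= delta.
  have := le_trans (fnorm_gapr X0 Y0 Xs Ys Q) (ltW hQ).
  by rewrite orthogonal_invmx// trmxK.
have hD : dist (X0 *m Q) (Y0 *m Q) Xs Ys <= delta.
  rewrite dist_mul_orthogonal//.
  by rewrite (le_trans (dist_le_gap _ _ _ _ (orthogonal_unit QQ)))// ltW.
have hdelta : 150 * 1000 * (a ^+ 3 * delta) <= b ^+ 4.
  have -> : 150 * 1000 * (a ^+ 3 * delta) = 300 * 1000 * c * b ^+ 4.
    by rewrite /delta; field; rewrite gt_eqF.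
  by rewrite ler_piMl// exprn_ge0// ltW.
have [_ _] := gd_linear_convergence UU VV b0 ba hd eta0 eta_le hdelta hX hY hD t.
(* The bound for the start rotated by [Q] is carried back: the iterates rotate along, and [dist]
   does not see the rotation. *)
rewrite -[U *m _]/Xs -[V *m _]/Ys (gd_mul_orthogonal _ _ _ _ _ _ QQ) /=.
rewrite (dist_mul_orthogonal X0 Y0 _ _ QQ) dist_mul_orthogonal//.
by rewrite ME -aE kE.
Qed.
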